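(* If $X$ and $Y$ are Banach spaces and $Y$ is uniformly convex, then $(X,Y)$ has the bounded BPBp-$m$.
   Context: Banach spaces are over $\mathbb{K}=\mathbb{R}$ or $\mathbb{C}$ and are nonzero. $\mathcal{L}(X,Y)$ is the space of bounded linear operators from $X$ to $Y$ with the operator norm; $S_X$ is the unit sphere of $X$. For $T\in\mathcal{L}(X,Y)$, $m(T):=\inf\{\|T(x)\|: x\in S_X\}$. A pair of Banach spaces $(X,Y)$ has the bounded Bishop-Phelps-Bollobás property for the minimum norm (bounded BPBp-$m$) if given $\varepsilon>0$ and $0\leq\rho\leq R$ there exists some $\eta(\varepsilon,R,\rho)\in(0,1)$ (converging to $0$ as $\varepsilon\to0$) such that whenever $x\in S_X$ and $T\in\mathcal{L}(X,Y)$ with $\|T\|\leq R$ and $m(T)=\rho$ satisfy $\|T(x)\|<m(T)(1+\eta(\varepsilon,R,\rho))$ if $\rho>0$, or $\|T(x)\|<\eta(\varepsilon,R,\rho)$ if $\rho=0$, there exist $S\in\mathcal{L}(X,Y)$ and $y\in S_X$ such that $\|S(y)\|=m(S)=m(T)=\rho$, $\|T-S\|<\varepsilon$, and $\|x-y\|<\varepsilon$. *)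

(* Defs.v *)
From HB Require Import structures.
From mathcomp Require Import all_boot all_order all_algebra.
From mathcomp Require Import all_classical all_reals all_analysis.
From mathcomp.real_closed Require Import complex.

Set Implicit Arguments.
Unset Strict Implicit.
Unset Printing Implicit Defensive.

Import Order.TTheory GRing.Theory Num.Theory.
Import numFieldNormedType.Exports.

Local Open Scope classical_set_scope.
Local Open Scope ring_scope.

(* The norm of a normed module over [K] takes its values in [K].  To treat
   [K = R] and [K = R[i]] at once and still take infima and suprema in [R],
   every definition carries a map [re : K -> R] reading off the real number
   behind such a value; it is only used with [re = fun a => a] when [K = R], and
   with [re = Re] when [K = R[i]] (where norms have zero imaginary part). *)
Definition rnorm (R : realType) (K : numFieldType) (re : K -> R)
    (V : normedModType K) (v : V) : R :=
  re `|v|.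

Definition unit_sphere (K : numFieldType) (V : normedModType K) : set V :=
  [set v | `|v| = 1].

Definition opnorm (R : realType) (K : numFieldType) (re : K -> R)
    (X Y : normedModType K) (T : X -> Y) : R :=
  sup [set rnorm re (T x) | x in @unit_sphere K X].

Definition minnorm (R : realType) (K : numFieldType) (re : K -> R)
    (X Y : normedModType K) (T : X -> Y) : R :=
  inf [set rnorm re (T x) | x in @unit_sphere K X].

(* For linear maps this is boundedness on bounded sets, equivalently
   continuity: see [linear_boundedP] and [linear_bounded_continuous]. *)
Definition bounded_op (K : numFieldType) (X Y : normedModType K)
    (T : {linear X -> Y}) : Prop :=
  bounded_near T (nbhs (0 : X)).

Definition uniformly_convex (R : realType) (K : numFieldType) (re : K -> R)
    (Y : normedModType K) : Prop :=
  forall e : R, 0 < e -> exists2 d : R, 0 < d &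
    forall y z : Y, unit_sphere y -> unit_sphere z ->
      e <= rnorm re (y - z) -> rnorm re (2^-1 *: (y + z)) <= 1 - d.

(* [eta e r rho] is $\eta(\varepsilon, R, \rho)$; the scalar field being
   called [R] here, the bound on the operator norm is [r]. *)
Definition bounded_BPBp_m (R : realType) (K : numFieldType) (re : K -> R)
    (X Y : normedModType K) : Prop :=
  exists eta : R -> R -> R -> R,
    (forall r rho : R, 0 <= rho -> rho <= r ->
       eta e r rho @[e --> 0^'+] --> (0 : R)) /\
    (forall e r rho : R, 0 < e -> 0 <= rho -> rho <= r ->
       (0 < eta e r rho < 1) /\
       forall (T : {linear X -> Y}) (x : X),
         bounded_op T -> unit_sphere x ->
         opnorm re T <= r -> minnorm re T = rho ->
         (0 < rho -> rnorm re (T x) < minnorm re T * (1 + eta e r rho)) ->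
         (rho = 0 -> rnorm re (T x) < eta e r rho) ->
         exists (S : {linear X -> Y}) (y : X),
           [/\ bounded_op S, unit_sphere y,
               [/\ rnorm re (S y) = minnorm re S,
                   minnorm re S = minnorm re T & minnorm re T = rho],
               opnorm re (fun u => T u - S u) < e &
               rnorm re (x - y) < e]).

(* Main.v *)
Require Import Defs.
From HB Require Import structures.
From mathcomp Require Import all_boot all_order all_algebra.
From mathcomp Require Import all_classical all_reals all_analysis.
From mathcomp.real_closed Require Import complex.
From mathcomp Require Import ring lra.

(* Let T have minimum norm rho > 0, nearly attained at x, and let g be a norming
   functional of T x.  Lowering T in the direction of T x, i.e. replacing T by
   T - delta g(T .) T x / |T x| and rescaling the minimum norm back to rho,
   forces every near-minimizer x' to satisfy |g (T x')| close to |T x'|.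
   Uniform convexity of Y then puts T x', up to a phase, close to T x, and x'
   close to x because T is bounded below.  Iterating with geometrically
   decreasing delta gives Cauchy sequences of operators and of unit vectors,
   whose limits attain the minimum norm.  If rho = 0, then T - g(.) T x, with g
   a norming functional of x, vanishes at x. *)

Set Implicit Arguments.
Unset Strict Implicit.
Unset Printing Implicit Defensive.

Import Order.TTheory GRing.Theory Num.Theory.
Import numFieldNormedType.Exports.

Local Open Scope classical_set_scope.
Local Open Scope ring_scope.

(** * Hahn-Banach theorem for sublinear functionals *)

Section Sublinear.
Variables (R : realType) (K : numFieldType) (c : {rmorphism R -> K}).
Variable V : lmodType K.

(** Homogeneity is over the reals, embedded by [c]: a space over [K] is treated as a real vector
    space. *)
Definition sublinear (q : V -> R) :=
  (forall u v, q (u + v) <= q u + q v) /\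
  (forall r u, 0 < r -> q (c r *: u) = r * q u).

Lemma sublinear0 q : sublinear q -> q 0 = 0.
Proof.
move=> [_ qZ]; have := qZ 2 0 (ltr0Sn _ 1); rewrite scaler0 => q2.
by lra.
Qed.

Lemma sublinear_ge0Z q r u : sublinear q -> 0 <= r -> q (c r *: u) = r * q u.
Proof.
move=> qS; rewrite le_eqVlt => /predU1P[<-|r0]; last exact: (proj2 qS).
by rewrite rmorph0 scale0r sublinear0// mul0r.
Qed.

Lemma sublinear_opp q u : sublinear q -> - q (- u) <= q u.
Proof.
move=> qS; have := proj1 qS u (- u).
by rewrite subrr sublinear0//; lra.
Qed.

(* The largest sublinear [f <= q] with [f (- a) = - q a].  A minimal [q] equals
   all its tilts, which forces it to be additive. *)
Definition tilt (q : V -> R) (a x : V) : R :=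
  inf [set q (x + c t *: a) - t * q a | t in [set t | 0 <= t]].

Lemma tilt_has_lbound q a x : sublinear q ->
  has_lbound [set q (x + c t *: a) - t * q a | t in [set t | 0 <= t]].
Proof.
move=> qS; exists (- q (- x)) => _ [t t0 <-].
rewrite -(sublinear_ge0Z a qS t0).
have := proj1 qS (x + c t *: a) (- x).
by rewrite addrAC subrr add0r; lra.
Qed.

Lemma tilt_le q a x t : sublinear q -> 0 <= t ->
  tilt q a x <= q (x + c t *: a) - t * q a.
Proof.
move=> qS t0; apply: ge_inf; first exact: tilt_has_lbound.
by exists t.
Qed.

Lemma le_tilt q a x b :
  (forall t, 0 <= t -> b <= q (x + c t *: a) - t * q a) -> b <= tilt q a x.
Proof.
move=> bP; apply: lb_le_inf => [|_ [t t0 <-]]; last exact: bP.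
by exists (q (x + c 0 *: a) - 0 * q a), 0 => /=.
Qed.

Lemma tilt_le_id q a x : sublinear q -> tilt q a x <= q x.
Proof.
move=> qS; apply: le_trans (tilt_le a x qS (lexx 0)) _.
by rewrite rmorph0 scale0r addr0 mul0r subr0.
Qed.

(** Competitors [s] for [u] and [t] for [v] combine to [s + t] for [u + v]. A competitor [t] for [u]
    scales to [r * t], which gives one half of homogeneity; the other half is the same inequality
    for the inverse of [r]. *)
Lemma sublinear_tilt q a : sublinear q -> sublinear (tilt q a).
Proof.
move=> qS; have [qD qZ] := qS; split=> [u v|].
  rewrite -lerBlDr; apply: le_tilt => s s0.
  rewrite lerBlDr -lerBlDl; apply: le_tilt => t t0.
  rewrite lerBlDl; apply: le_trans (tilt_le a _ qS (addr_ge0 s0 t0)) _.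
  rewrite rmorphD scalerDl addrACA mulrDl.
  by have := qD (u + c s *: a) (v + c t *: a); lra.
have tilt_leZ r u : 0 < r -> tilt q a (c r *: u) <= r * tilt q a u.
  move=> r0; rewrite -ler_pdivrMl//; apply: le_tilt => t t0.
  rewrite ler_pdivrMl//.
  apply: le_trans (tilt_le a _ qS (mulr_ge0 (ltW r0) t0)) _.
  by rewrite rmorphM -scalerA -scalerDr qZ// mulrBr mulrA.
move=> r u r0; apply/eqP; rewrite eq_le tilt_leZ//=.
rewrite -ler_pdivlMl//; apply: le_trans (tilt_leZ _ _ _); last by rewrite invr_gt0.
by rewrite scalerA -rmorphM mulVf ?gt_eqF// rmorph1 scale1r.
Qed.

(** Zorn's lemma applies because the pointwise infimum of a nonempty chain is again sublinear. *)
Lemma minimal_sublinear p : sublinear p ->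
  exists q, [/\ sublinear q, forall u, q u <= p u &
    forall q', sublinear q' -> (forall u, q' u <= q u) -> q' = q].
Proof.
move=> pS; pose T := {q | sublinear q /\ forall u, q u <= p u}.
(* The pointwise order is reversed, so that Zorn's maximal elements are minimal functionals. *)
pose below (q r : T) := `[< forall u, sval r u <= sval q u >].
have [|r s t|s t|A totA|[q [qS qp]] qmin] := @Zorn T below.
- by move=> t; apply/asboolP.
- by move=> /asboolP rs /asboolP st; apply/asboolP => u; exact: le_trans (rs u).
- case: s t => [s sP] [t tP] /asboolP /= st /asboolP /= ts; apply: eq_exist.
  by apply/funext => u; apply/eqP; rewrite eq_le st ts.
- have [->|/set0P A0] := eqVneq A set0.
    by exists (exist _ p (conj pS (fun u => lexx (p u)))).
  pose q u := inf [set sval s u | s in A].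
  have q_le s u : A s -> q u <= sval s u.
    move=> As; apply: ge_inf; last by exists s.
    (* This bound is the same for all members of the chain, so the infimum is finite. *)
    exists (- p (- u)) => _ [[t [tS tp]] At <-] /=.
    by apply: le_trans (sublinear_opp u tS); rewrite lerN2.
  have le_q b u : (forall s, A s -> b <= sval s u) -> b <= q u.
    move=> bP; apply: lb_le_inf => [|_ [s As <-]]; last exact: bP.
    by case: A0 => s As; exists (sval s u), s.
  have qS : sublinear q.
    split=> [u v|r u r0].
      rewrite -lerBlDr; apply: (le_q) => s As.
      rewrite lerBlDr -lerBlDl; apply: (le_q) => t At; rewrite lerBlDl.
      (* The smaller of the two members serves for both [u] and [v]. *)
      have [/asboolP st|/asboolP ts] := totA _ _ As At.
        apply: le_trans (q_le _ _ At) _.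
        apply: le_trans (proj1 (proj1 (svalP t)) _ _) _.
        by rewrite lerD2r.
      apply: le_trans (q_le _ _ As) _.
      apply: le_trans (proj1 (proj1 (svalP s)) _ _) _.
      by rewrite lerD2l.
    apply/eqP; rewrite eq_le; apply/andP; split.
      rewrite -ler_pdivrMl//; apply: (le_q) => s As; rewrite ler_pdivrMl//.
      by rewrite -(proj2 (proj1 (svalP s)))//; exact: q_le.
    apply: (le_q) => s As; rewrite (proj2 (proj1 (svalP s)))//.
    by rewrite ler_pM2l//; exact: q_le.
  have qp u : q u <= p u.
    by case: A0 => s As; apply: le_trans (q_le _ u As) (proj2 (svalP s) u).
  exists (exist _ q (conj qS qp)) => s As; apply/asboolP => u /=; exact: q_le.
exists q; split=> // q' q'S q'q.
have q'p u : q' u <= p u by exact: le_trans (qp u).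
have := qmin (exist _ q' (conj q'S q'p)) (asboolT q'q).
by move=> [].
Qed.

(** Minimality gives [tilt q v = q], and the competitor [t = 1] then yields
    [q u + q v <= q (u + v)]. Additivity extends homogeneity to negative scalars. *)
Lemma minimal_sublinear_linear q : sublinear q ->
  (forall q', sublinear q' -> (forall u, q' u <= q u) -> q' = q) ->
  (forall u v, q (u + v) = q u + q v) /\ (forall r u, q (c r *: u) = r * q u).
Proof.
move=> qS qmin; have tiltE a : tilt q a = q.
  by apply: qmin => [|u]; [exact: sublinear_tilt|exact: tilt_le_id].
have qD u v : q (u + v) = q u + q v.
  apply/eqP; rewrite eq_le (proj1 qS) /= -lerBrDr -[in leLHS](tiltE v).
  have := tilt_le v u qS ler01.
  by rewrite rmorph1 scale1r mul1r.
split=> // r u; have [r0|r0] := leP 0 r; first exact: sublinear_ge0Z.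
have := qD (c r *: u) (c (- r) *: u).
rewrite -scalerDl -rmorphD subrr rmorph0 scale0r (sublinear0 qS).
by rewrite (proj2 qS (- r)) ?oppr_gt0//; lra.
Qed.

(** The minimal functional is taken below [tilt p a] rather than [p]: its value at [- a] is then at
    most [- p a], which forces equality at [a]. *)
Lemma hahn_banach_sublinear p a : sublinear p ->
  exists f : V -> R, [/\ forall u v, f (u + v) = f u + f v,
    forall r u, f (c r *: u) = r * f u,
    forall u, f u <= p u & f a = p a].
Proof.
move=> pS.
have [q [qS qtilt qmin]] := minimal_sublinear (sublinear_tilt a pS).
have [qD qZ] := minimal_sublinear_linear qS qmin.
have qp u : q u <= p u by apply: le_trans (qtilt u) (tilt_le_id _ _ pS).
exists q; split=> //; apply/eqP; rewrite eq_le qp /=.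
have := le_trans (qtilt (- a)) (tilt_le a (- a) pS ler01).
rewrite rmorph1 scale1r addNr (sublinear0 pS) mul1r sub0r.
have := qD (- a) a; rewrite addNr (sublinear0 qS). lra.
Qed.

End Sublinear.

(** * Real and complex scalars *)

Lemma scalar_funZ (K : numFieldType) (V : lmodType K) (g : V -> K) :
  scalar g -> forall a u, g (a *: u) = a * g u.
Proof.
move=> gL a u; have g0 : g 0 = 0.
  by have := gL (-1) 0 0; rewrite scaler0 addr0 mulN1r addNr.
by rewrite -[a *: u]addr0 gL g0 addr0.
Qed.

(* Treats both scalar fields at once: [re] is the real part and [c] the
   inclusion of the reals. *)
Record real_scalars (R : realType) (K : numFieldType) (re : K -> R)
    (c : {rmorphism R -> K}) : Prop := RealScalars {
  rs_reD : forall a b, re (a + b) = re a + re b;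
  rs_reK : forall r, re (c r) = r;
  rs_ge0 : forall a, 0 <= a -> c (re a) = a;
  rs_le : forall r s, (c r <= c s) = (r <= s);
  rs_re_norm : forall a, re a <= re `|a|;
  rs_complexify : forall (V : lmodType K) (f : V -> R),
    (forall u v, f (u + v) = f u + f v) ->
    (forall r u, f (c r *: u) = r * f u) ->
    exists2 g : V -> K, scalar g & forall u, re (g u) = f u }.

Lemma real_scalars_real (R : realType) :
  real_scalars (fun a : R => a) (idfun : {rmorphism R -> R}).
Proof.
split=> // [|V f fD fZ]; first exact: ler_norm.
by exists f => // a u v; rewrite fD -(fZ a).
Qed.

Lemma real_scalars_complex (R : realType) :
  real_scalars (@complex.Re R) (real_complex R).
Proof.
split=> // [[a b] [d e]//|a a0|r s|a|V f fD fZ].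
- exact: (RRe_real (ger0_real a0)).
- exact: lecR.
- rewrite normc_def /= (le_trans (ler_norm _))// -sqrtr_sqr ler_wsqrtr//.
  by rewrite lerDl sqr_ge0.
(* The only possible choice: the imaginary part of a complex-linear functional at [u] is minus its
   real part at ['i *: u]. *)
- pose g u : R[i] := Complex (f u) (- f ('i%C *: u)).
  exists g => // [[a b] u v].
  have fiZ w : f ((a +i* b)%C *: w) = a * f w + b * f ('i%C *: w).
    rewrite -fZ -fZ -fD scalerA -scalerDl; congr (f (_ *: w)).
    by rewrite /real_complex_def; simpc.
  rewrite /g !fD scalerDr fD scalerA mulrC -scalerA !fiZ scalerA -expr2 sqr_i.
  rewrite scaleN1r.
  have -> : f (- u) = - f u.
    by rewrite -scaleN1r -(rmorph1 (real_complex R)) -rmorphN fZ mulN1r.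
  by simpc; congr (_ +i* _)%C; ring.
Qed.

(** * Real-valued norms and norming functionals *)

Section RealNorm.
Variables (R : realType) (K : numFieldType) (re : K -> R).
Variables (c : {rmorphism R -> K}) (scal : real_scalars re c).

Let reK := rs_reK scal.

Lemma rs_lt r s : (c r < c s) = (r < s).
Proof. by rewrite !lt_neqAle (inj_eq (can_inj reK)) (rs_le scal). Qed.

Lemma re_abs r : re `|c r| = `|r|.
Proof.
have abs_ge0 s : 0 <= s -> re `|c s| = s.
  by move=> s0; rewrite ger0_norm ?reK// -(rmorph0 c) (rs_le scal).
have [r0|r0] := ger0P r; first exact: abs_ge0.
by rewrite -[`|c r|]normrN -rmorphN abs_ge0// oppr_ge0 ltW.
Qed.

Lemma re_absM a b : re `|a * b| = re `|a| * re `|b|.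
Proof.
apply: (can_inj reK).
by rewrite rmorphM !(rs_ge0 scal)// normrM.
Qed.

Section Norm.
Variable V : normedModType K.
Local Notation N := (rnorm re).

Lemma rnormE (v : V) : c (N v) = `|v|.
Proof. exact: (rs_ge0 scal). Qed.

Lemma rnorm_ge0 (v : V) : 0 <= N v.
Proof. by rewrite -(rs_le scal) rnormE rmorph0. Qed.

Lemma ler_rnormD (u v : V) : N (u + v) <= N u + N v.
Proof. by rewrite -(rs_le scal) rmorphD !rnormE ler_normD. Qed.

Lemma rnormN (v : V) : N (- v) = N v.
Proof. by rewrite /rnorm normrN. Qed.

Lemma rnormB (u v : V) : N (u - v) = N (v - u).
Proof. by rewrite /rnorm distrC. Qed.

Lemma ler_rnorm_dist (w u v : V) : N (u - v) <= N (u - w) + N (w - v).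
Proof. by apply: le_trans (ler_rnormD _ _); rewrite addrA subrK. Qed.

Lemma rnormZ a (v : V) : N (a *: v) = re `|a| * N v.
Proof.
apply: (can_inj reK).
by rewrite rmorphM !rnormE (rs_ge0 scal)// normrZ.
Qed.

Lemma rnormZr r (v : V) : N (c r *: v) = `|r| * N v.
Proof. by rewrite rnormZ re_abs. Qed.

Lemma rnorm_eq0 (v : V) : (N v == 0) = (v == 0).
Proof.
by rewrite -[RHS]normr_eq0 -rnormE -[in RHS](rmorph0 c) (inj_eq (can_inj reK)).
Qed.

Lemma rnorm0 : N (0 : V) = 0.
Proof. by apply/eqP; rewrite rnorm_eq0. Qed.

Lemma unit_sphereE (v : V) : unit_sphere v <-> N v = 1.
Proof.
rewrite /unit_sphere /= -rnormE -(rmorph1 c).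
by split=> [/(can_inj reK)|->].
Qed.

Lemma re_norm1 : re `|1| = 1.
Proof. by rewrite normr1 -(rmorph1 c) reK. Qed.

Lemma exists_phase (a : K) : exists2 t : K, re `|t| = 1 & t * a = `|a|.
Proof.
have [->|a0] := eqVneq a 0.
  by exists 1; [exact: re_norm1|rewrite mulr0 normr0].
exists (`|a| / a); last by rewrite divfK.
by rewrite normf_div normr_id divff ?normr_eq0// -(rmorph1 c) reK.
Qed.

(** Hahn-Banach for the norm gives a real functional, which is then made [K]-linear. Rotating [u] by
    a phase turns the modulus of [g u] into a value of the real functional, so the norm bound
    survives. *)
Lemma norming_functional (v : V) : exists g : V -> K,
  [/\ scalar g, forall u, re `|g u| <= N u & g v = `|v| ].
Proof.
have NS : sublinear c (rnorm re (V := V)).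
  by split=> [|r u r0]; [exact: ler_rnormD|rewrite rnormZr gtr0_norm].
have [f [fD fZ fN fv]] := hahn_banach_sublinear v NS.
have [g gL gf] := rs_complexify scal fD fZ.
have gZ := scalar_funZ gL.
have gN u : re `|g u| <= N u.
  have [t t1 <-] := exists_phase (g u).
  by rewrite -gZ gf (le_trans (fN _))// rnormZ t1 mul1r.
(* This phase makes the value at [v] equal to its modulus, which is at least the real part [f v],
   the norm of [v]. *)
have [t t1 tg] := exists_phase (g v).
exists (fun u => t * g u); split=> [a x y|u|].
- by rewrite gL mulrDr mulrCA.
- by rewrite re_absM t1 mul1r.
- rewrite tg -rnormE -[LHS](rs_ge0 scal)//; congr (c _).
  apply/eqP; rewrite eq_le gN -fv -gf; exact: (rs_re_norm scal).
Qed.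

End Norm.
End RealNorm.

(** * Geometric sequences and completeness *)

Section GeometricSequences.
Variable R : realType.
Local Notation h k := ((2^-1 : R) ^+ k).

Lemma geom_gt0 k : 0 < h k.
Proof. by rewrite exprn_gt0// invr_gt0. Qed.

Lemma geomS k : h k = 2 * h k.+1.
Proof. by rewrite exprS mulrA divff// mul1r. Qed.

Lemma exists_geom_lt (C e : R) : 0 < e -> exists k, C * h k < e.
Proof.
move=> e0; have C0 : 0 <= `|C| / e by rewrite divr_ge0// ltW.
have := archi_boundP C0; set k := Num.bound _ => Ck; exists k.
apply: le_lt_trans (_ : `|C| * h k < e).
  by rewrite ler_wpM2r ?ler_norm// ltW// geom_gt0.
rewrite exprVn ltr_pdivrMr ?exprn_gt0//.
move: Ck; rewrite ltr_pdivrMr// mulrC => /lt_trans; apply.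
by rewrite ltr_pM2l// -natrX ltr_nat ltn_expl.
Qed.

(** Stands in for passage to the limit in inequalities with a geometrically small error. *)
Lemma ler_addgeom (a b C : R) : (forall k, a <= b + C * h k) -> a <= b.
Proof.
move=> abC; apply/ler_addgt0Pr => e /(exists_geom_lt C)[k Ck].
by apply: le_trans (abC k) _; rewrite lerD2l ltW.
Qed.

Section Complete.
Variables (K : numFieldType) (re : K -> R).
Variables (c : {rmorphism R -> K}) (scal : real_scalars re c).
Local Notation N := (rnorm re).

Lemma geometric_cvg (V : completeNormedModType K) (u : nat -> V) (C : R) :
  (forall k, N (u k.+1 - u k) <= C * h k) ->
  exists l, forall k, N (u k - l) <= 2 * C * h k.
Proof.
move=> uC; have far j k : N (u (k + j)%N - u k) <= 2 * C * h k.
  have C0 : 0 <= C.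
    by have := le_trans (rnorm_ge0 scal _) (uC 0%N); rewrite expr0 mulr1.
  (* Keeping the difference of powers makes the induction on [j] close. *)
  suff : N (u (k + j)%N - u k) <= 2 * C * (h k - h (k + j)%N).
    move=> /le_trans; apply; rewrite ler_wpM2l ?mulr_ge0//.
    by rewrite gerBl ltW// geom_gt0.
  elim: j => [|j IH]; first by rewrite addn0 !subrr mulr0 (rnorm0 scal).
  rewrite addnS; have := ler_rnorm_dist scal (u (k + j)%N) (u (k + j).+1) (u k).
  have := uC (k + j)%N; have := geomS (k + j); nra.
have cu : cvgn u.
  apply/cauchy_cvgP/cauchy_exP => e e0.
  have e0' : 0 < re e.
    by rewrite -(rs_lt scal) rmorph0 (rs_ge0 scal) ?ltW.
  have [k Ck] := exists_geom_lt (2 * C) e0'.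
  exists (u k), k => // n /= kn.
  rewrite -ball_normE /= distrC -(rnormE scal) -(rs_ge0 scal (ltW e0)).
  by rewrite (rs_lt scal); apply: le_lt_trans Ck; rewrite -(subnKC kn).
exists (limn u) => k; apply/ler_addgt0Pr => e e0.
have ce0 : 0 < c e by rewrite -(rmorph0 c) (rs_lt scal).
have [n _ un] := (cvgrPdist_le _ _).1 cu _ ce0.
have := un (k + n)%N (leq_addl _ _).
rewrite -(rnormE scal) (rs_le scal) => le_e.
apply: le_trans (ler_rnorm_dist scal (u (k + n)%N) _ _) _.
by rewrite lerD// (rnormB re)//; exact: far.
Qed.

End Complete.
End GeometricSequences.

(** * Operator norm, minimum norm and uniform convexity *)

Lemma linear_of_fun (K : numFieldType) (X Y : lmodType K) (f : X -> Y) :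
  linear f -> exists F : {linear X -> Y}, F =1 f.
Proof.
move=> fL; pose m := GRing.isLinear.Build K X Y *:%R f fL.
by exists (HB.pack_for {linear X -> Y} f m).
Qed.

Section Operators.
Variables (R : realType) (K : numFieldType) (re : K -> R).
Variables (c : {rmorphism R -> K}) (scal : real_scalars re c).
Variables X Y : normedModType K.
Local Notation N := (rnorm re).

Lemma unit_boundZ (F : {linear X -> Y}) (C : R) :
  (forall u, N u = 1 -> N (F u) <= C) -> forall u, N (F u) <= C * N u.
Proof.
move=> FC u; have [->|u0] := eqVneq u 0.
  by rewrite linear0 !(rnorm0 scal) mulr0.
have Nu : 0 < N u by rewrite lt_def (rnorm_eq0 scal) u0 (rnorm_ge0 scal).
have := FC (c (N u)^-1 *: u).
rewrite linearZ /= !(rnormZr scal) gtr0_norm ?invr_gt0//.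
by rewrite mulVf ?gt_eqF// ler_pdivrMl// mulrC => ->.
Qed.

Lemma minnorm_le (F : {linear X -> Y}) u : minnorm re F * N u <= N (F u).
Proof.
have [->|u0] := eqVneq u 0.
  by rewrite (rnorm0 scal) mulr0 (rnorm_ge0 scal).
have Nu : 0 < N u by rewrite lt_def (rnorm_eq0 scal) u0 (rnorm_ge0 scal).
rewrite -ler_pdivlMr//; apply: ge_inf.
  by exists 0 => _ [v _ <-]; exact: (rnorm_ge0 scal).
exists (c (N u)^-1 *: u).
  apply/(unit_sphereE scal); rewrite (rnormZr scal).
  by rewrite gtr0_norm ?invr_gt0// mulVf// gt_eqF.
by rewrite linearZ /= (rnormZr scal) gtr0_norm ?invr_gt0// mulrC.
Qed.

Lemma le_minnorm (F : X -> Y) (x : X) b : N x = 1 ->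
  (forall u, N u = 1 -> b <= N (F u)) -> b <= minnorm re F.
Proof.
move=> x1 bF; apply: lb_le_inf => [|_ [u /(unit_sphereE scal)u1 <-]].
  by exists (N (F x)), x => //; apply/(unit_sphereE scal).
exact: bF.
Qed.

Lemma minnorm_adherent (F : X -> Y) (x : X) e : N x = 1 -> 0 < e ->
  exists2 u : X, N u = 1 & N (F u) < minnorm re F + e.
Proof.
move=> x1 e0.
have [|_ [u /(unit_sphereE scal)u1 <-] ue] := @inf_adherent _
    [set N (F u) | u in @unit_sphere K X] _ e0; last by exists u.
split; first by exists (N (F x)), x => //; apply/(unit_sphereE scal).
by exists 0 => _ [u _ <-]; exact: (rnorm_ge0 scal).
Qed.

Lemma minnorm_attained (F : {linear X -> Y}) (y : X) b : N y = 1 ->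
  (forall u, b * N u <= N (F u)) -> N (F y) = b -> minnorm re F = b.
Proof.
move=> y1 bF Fy; apply/eqP; rewrite eq_le (le_minnorm y1) ?andbT.
  by have := minnorm_le F y; rewrite y1 mulr1 Fy.
by move=> u u1; have := bF u; rewrite u1 mulr1.
Qed.

Lemma bounded_opP (F : {linear X -> Y}) :
  bounded_op F <-> exists C, forall u, N (F u) <= C * N u.
Proof.
split=> [/linear_boundedP/pinfty_ex_gt0[r r0 Fr]|[C FC]].
  exists (re r) => u.
  by rewrite -(rs_le scal) rmorphM !(rnormE scal) (rs_ge0 scal (ltW r0)).
apply/linear_boundedP; exists (c `|C|); split.
  by rewrite ger0_real// -(rmorph0 c) (rs_le scal).
move=> r /ltW Cr u.
apply: le_trans (ler_wpM2r (normr_ge0 u) Cr).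
rewrite -!(rnormE scal) -rmorphM (rs_le scal) (le_trans (FC u))//.
by rewrite ler_wpM2r ?(rnorm_ge0 scal)// ler_norm.
Qed.

Lemma opnorm_ge (F : {linear X -> Y}) u :
  bounded_op F -> N (F u) <= opnorm re F * N u.
Proof.
move=> /bounded_opP[C FC]; apply: unit_boundZ => {}u u1.
apply: ub_le_sup; last by exists u => //; apply/(unit_sphereE scal).
exists C => _ [v /(unit_sphereE scal)v1 <-].
by rewrite (le_trans (FC v))// v1 mulr1.
Qed.

Lemma opnorm_le (F : X -> Y) (x : X) b : N x = 1 ->
  (forall u, N u = 1 -> N (F u) <= b) -> opnorm re F <= b.
Proof.
move=> x1 Fb; apply: sup_le_ub.
  by exists (N (F x)), x => //; apply/(unit_sphereE scal).
by move=> _ [u /(unit_sphereE scal)u1 <-]; exact: Fb.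
Qed.

(* A vector at which a norming functional of [z] is nearly maximal is, up to a
   phase, close to [z]: otherwise their midpoint would be short. *)
Lemma uniformly_convex_align : uniformly_convex re Y ->
  forall e : R, 0 < e -> exists2 d : R, 0 < d & forall (g : Y -> K) (z w : Y),
    scalar g -> (forall u, re `|g u| <= N u) -> g z = 1 ->
    N z = 1 -> N w = 1 -> 1 - d < re `|g w| ->
    exists2 t, re `|t| = 1 & N (t *: w - z) < e.
Proof.
move=> Yuc e /Yuc[d d0 dP]; exists d => // g z w gL gN gz z1 w1 gw.
have [t t1 tg] := exists_phase scal (g w).
exists t => //; rewrite ltNge; apply/negP => e_le.
have gZ := scalar_funZ gL.
have tw1 : unit_sphere (t *: w).
  by apply/(unit_sphereE scal); rewrite (rnormZ scal) t1 mul1r.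
have := dP _ _ tw1 ((unit_sphereE scal z).2 z1) e_le.
apply/negP; rewrite -ltNge; apply: lt_le_trans (gN _).
have c2 : 2^-1 = c 2^-1 by rewrite fmorphV rmorph_nat.
rewrite gZ gL tg gz -[`|g w|](rs_ge0 scal)// c2 -(rmorph1 c) -rmorphD -rmorphM.
rewrite (re_abs scal); apply: lt_le_trans (ler_norm _).
move: gw; lra.
Qed.

End Operators.

(** * One perturbation step *)

Section Approximation.
Variables (R : realType) (K : numFieldType) (re : K -> R).
Variables (c : {rmorphism R -> K}) (scal : real_scalars re c).
Local Notation N := (rnorm re).
Local Notation h k := ((2^-1 : R) ^+ k).

(** Here [t0] and [t] are the norms of [T x] and [T y1], where [y1] nearly minimizes the lowered
    operator [T'], [gam] is the modulus of [g (T y1)], and [m] is the minimum norm of [T']. Lowering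
    gains the full factor [1 - delta] at [x], but at most [delta * gam] at [y1]; since [t >= 1], a
    small [gam] would leave [T' y1] too long. *)
Lemma step_estimate (delta d eta m t0 t gam : R) :
  0 < delta -> delta <= 2^-1 -> 0 < eta -> eta <= 1 -> 3 * eta <= d * delta ->
  1 <= t -> gam <= t -> t0 < 1 + eta -> m <= (1 - delta) * t0 ->
  t - delta * gam < m * (1 + eta) -> t < 1 + 3 * eta /\ (1 - d) * t < gam.
Proof.
move=> d0 d2 e0 e1 ed t1 gt t01 mt lt.
have mlt : t - delta * gam < (1 - delta) * (1 + 3 * eta).
  apply: lt_le_trans lt _.
  apply: le_trans (_ : (1 - delta) * t0 * (1 + eta) <= _).
    by rewrite ler_wpM2r//; lra.
  rewrite -mulrA ler_wpM2l//; [lra|nra].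
split; first by nra.
rewrite -(ltr_pM2l d0); nra.
Qed.

(** The minimum norm is normalized to be at least 1. While [eta] is tied to the size [eps] of the
    change, [eta'] is arbitrary: the new pair can be brought as near to attainment as the next,
    finer step demands. *)
Lemma perturbation_step (X Y : normedModType K) : uniformly_convex re Y ->
  forall M eps : R, 0 < M -> 0 < eps -> exists2 eta, 0 < eta &
  forall (T : {linear X -> Y}) (x : X), (forall u, N (T u) <= M * N u) ->
    (forall u, N u <= N (T u)) -> N x = 1 -> N (T x) < 1 + eta ->
  forall eta', 0 < eta' -> exists (S : {linear X -> Y}) (y : X),
    [/\ forall u, N u <= N (S u), N y = 1, N (S y) < 1 + eta',
        forall u, N (S u - T u) <= eps * N u & N (y - x) <= eps].
Proof.
move=> Yuc M eps M0 eps0.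
have e40 : 0 < eps / 4 by rewrite divr_gt0.
have [d d0 dP] := uniformly_convex_align scal Yuc e40.
(* Lowering moves [T] by at most [delta * M], rescaling by at most [2 * delta] times [2 * M]; hence
   the 5. *)
pose delta := Num.min 2^-1 (eps / (5 * M)).
have delta0 : 0 < delta by rewrite lt_min invr_gt0 ltr0n divr_gt0// mulr_gt0.
have delta2 : delta <= 2^-1 by rewrite ge_min lexx.
have deltaM : 5 * delta * M <= eps.
  have : delta <= eps / (5 * M) by rewrite ge_min lexx orbT.
  by rewrite ler_pdivlMr ?mulr_gt0//; lra.
clearbody delta.
(* The bounds serve, in order, for [t <= 2], for [m <= 1], for a length difference of at most
   [eps / 2], and for [step_estimate]. *)
pose eta := Num.min (Num.min 3^-1 delta) (Num.min (eps / 6) (d * delta / 3)).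
have eta0 : 0 < eta.
  by rewrite !lt_min invr_gt0 ltr0n delta0 !divr_gt0// mulr_gt0.
have eta3 : 3 * eta <= 1.
  have : eta <= 3^-1 by rewrite !ge_min lexx.
  lra.
have etadelta : eta <= delta by rewrite !ge_min lexx orbT.
have etaeps : 6 * eta <= eps.
  have : eta <= eps / 6 by rewrite !ge_min lexx !orbT.
  lra.
have etad : 3 * eta <= d * delta.
  have : eta <= d * delta / 3 by rewrite !ge_min lexx !orbT.
  lra.
clearbody eta.
exists eta => // T x TM Tlow x1 Tx eta' eta'0.
pose z := T x; pose t0 := N z.
have t01 : 1 <= t0 by rewrite -x1; exact: Tlow.
have t00 : 0 < t0 by lra.
rewrite -/z -/t0 in Tx.
have [g [gL gN gz]] := norming_functional scal z.
have gZ := scalar_funZ gL.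
(* Since [g z = t0], this gives [T' x = (1 - delta) z]. *)
have [T' T'E] : exists T' : {linear X -> Y},
    forall u, T' u = T u - (c (delta / t0) * g (T u)) *: z.
  apply: linear_of_fun => a u v /=.
  rewrite linearP gL mulrDr scalerDl opprD addrACA scalerBr scalerA.
  by rewrite mulrCA.
have TT' u : N (T u - T' u) = delta * re `|g (T u)|.
  rewrite T'E opprB addrC subrK (rnormZ scal) (re_absM scal) (re_abs scal).
  rewrite gtr0_norm ?divr_gt0// -/t0.
  by field; rewrite gt_eqF.
have T'ge u : N (T u) - delta * re `|g (T u)| <= N (T' u).
  by have := ler_rnorm_dist scal (T' u) (T u) 0; rewrite !subr0 TT'; lra.
have gT u : 0 <= re `|g (T u)| <= N (T u).
  by rewrite gN andbT -(rs_le scal) rmorph0 (rs_ge0 scal).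
pose m := minnorm re T'.
have m_low : 1 - delta <= m.
  apply: (le_minnorm scal x1) => u u1.
  have := T'ge u; have := gT u; have := Tlow u; rewrite u1 => ? /andP[? ?]; nra.
have m_up : m <= (1 - delta) * t0.
  have := minnorm_le scal T' x; rewrite x1 mulr1 => /le_trans; apply.
  rewrite T'E -/z gz -(rnormE scal) -rmorphM -/t0 divfK ?gt_eqF//.
  rewrite -[X in X - _]scale1r -(rmorph1 c) -scalerBl -rmorphB (rnormZr scal).
  by rewrite ger0_norm//; lra.
have m0 : 0 < m by lra.
(* [eta'] is for the conclusion, [eta] for [step_estimate]. *)
pose eta2 := Num.min eta' eta.
have eta20 : 0 < eta2 by rewrite lt_min eta'0.
have [y1 y11 T'y1] := minnorm_adherent scal T' x1 (mulr_gt0 m0 eta20).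
pose t := N (T y1); pose gam := re `|g (T y1)|.
have t1 : 1 <= t by rewrite -y11; exact: Tlow.
have t0' : 0 < t by lra.
have [tlt gamlt] : t < 1 + 3 * eta /\ (1 - d) * t < gam.
  apply: (@step_estimate delta d eta m t0 t gam) => //; first lra.
    by have /andP[] := gT y1.
  have eta2le : eta2 <= eta by rewrite ge_min lexx orbT.
  have := T'ge y1; rewrite -/t -/gam; rewrite -/m in T'y1; nra.
pose w := c t^-1 *: T y1; pose zn := c t0^-1 *: z.
have w1 : N w = 1.
  by rewrite (rnormZr scal) gtr0_norm ?invr_gt0// mulVf// gt_eqF.
have zn1 : N zn = 1.
  by rewrite (rnormZr scal) gtr0_norm ?invr_gt0// mulVf// gt_eqF.
have gzn : g zn = 1.
  by rewrite gZ gz -(rnormE scal) -rmorphM mulVf ?gt_eqF// rmorph1.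
have gw : 1 - d < re `|g w|.
  rewrite gZ (re_absM scal) (re_abs scal) gtr0_norm ?invr_gt0//.
  by rewrite mulrC ltr_pdivlMr.
have [th th1 thw] := dP g zn w gL gN gzn zn1 w1 gw.
have [S SE] : exists S : {linear X -> Y}, forall u, S u = c m^-1 *: T' u.
  apply: linear_of_fun => a u v.
  by rewrite linearP scalerDr !scalerA mulrC.
have NS u : N (S u) = m^-1 * N (T' u).
  by rewrite SE (rnormZr scal) gtr0_norm ?invr_gt0.
exists S, (th *: y1); split=> [u| | |u|].
- by rewrite NS mulrC ler_pdivlMr// mulrC; exact: (minnorm_le scal).
- by rewrite (rnormZ scal) th1 mul1r.
- rewrite linearZ /= (rnormZ scal) th1 mul1r NS mulrC ltr_pdivrMr// mulrC.
  apply: lt_le_trans T'y1 _; rewrite -/m mulrDr mulr1 lerD2l ler_pM2l//.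
  by rewrite ge_min lexx.
- have m1 : m <= 1 by apply: le_trans m_up _; nra.
  have Sm : N (S u - T' u) = (m^-1 - 1) * N (T' u).
    rewrite SE -[X in _ - X]scale1r -(rmorph1 c) -scalerBl -rmorphB.
    by rewrite (rnormZr scal) ger0_norm// subr_ge0 invf_ge1.
  (* From [m >= 1 - delta] and [delta <= 1/2]. *)
  have mV : m^-1 - 1 <= 2 * delta.
    by rewrite lerBlDr -div1r ler_pdivrMr//; nra.
  have mV0 : 0 <= m^-1 - 1 by rewrite subr_ge0 invf_ge1.
  have := ler_rnorm_dist scal (T' u) (S u) (T u).
  rewrite Sm (rnormB re (T' u) (T u)) TT'.
  have := ler_rnorm_dist scal (T u) (T' u) 0.
  rewrite !subr0 (rnormB re (T' u) (T u)) TT'.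
  have := TM u; have /andP[? ?] := gT u; have Nu := rnorm_ge0 scal u.
  have := rnorm_ge0 scal (T' u).
  move=> T'0 TMu T'u Sd; apply: le_trans Sd _.
  have gM : delta * re `|g (T u)| <= delta * (M * N u) by nra.
  have T'2 : N (T' u) <= 2 * (M * N u) by nra.
  have : (m^-1 - 1) * N (T' u) <= 2 * delta * (2 * (M * N u)).
    by apply: ler_pM.
  nra.
(* As [T] does not shrink norms, the distance is measured after applying [T]. It splits into a
   difference of directions, at most [t * (eps / 4) <= eps / 2], and one of lengths, at most
   [3 * eta <= eps / 2]. *)
- apply: le_trans (Tlow _) _; rewrite linearB linearZ /= -/z.
  have -> : th *: T y1 - z = c t *: (th *: w - zn) + c (t - t0) *: zn.
    rewrite scalerBr rmorphB scalerBl addrA subrK.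
    rewrite /w /zn !scalerA [c t * th]mulrC -mulrA -!rmorphM !divff ?gt_eqF//.
    by rewrite rmorph1 mulr1 scale1r.
  apply: le_trans (ler_rnormD scal _ _) _.
  rewrite (rnormZr scal t) (rnormZr scal (t - t0)) zn1 mulr1 gtr0_norm//.
  have : `|t - t0| <= 3 * eta by rewrite ler_norml; lra.
  nra.
Qed.

End Approximation.

(** * Iteration to attainment and the bounded BPBp-m *)

Section Main.
Variables (R : realType) (K : numFieldType) (re : K -> R).
Variables (c : {rmorphism R -> K}) (scal : real_scalars re c).
Local Notation N := (rnorm re).
Local Notation h k := ((2^-1 : R) ^+ k).

(** The steps have sizes [eps / 2 * h k], with sum [eps], so the bound [M + eps] holds for all
    operators of the iteration and can be fixed in advance. *)
Lemma minnorm1_attaining_approximation (X Y : completeNormedModType K) :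
  uniformly_convex re Y ->
  forall M eps : R, 0 < M -> 0 < eps -> exists2 eta, 0 < eta &
  forall (T : {linear X -> Y}) (x : X), (forall u, N (T u) <= M * N u) ->
    (forall u, N u <= N (T u)) -> N x = 1 -> N (T x) < 1 + eta ->
  exists (S : {linear X -> Y}) (y : X),
    [/\ forall u, N u <= N (S u), N y = 1, N (S y) = 1,
        forall u, N (S u - T u) <= eps * N u & N (y - x) <= eps].
Proof.
move=> Yuc M eps M0 eps0.
have Me0 : 0 < M + eps by rewrite addr_gt0.
pose step (e eta : R) := 0 < eta /\
  forall (T : {linear X -> Y}) (x : X), (forall u, N (T u) <= (M + eps) * N u) ->
    (forall u, N u <= N (T u)) -> N x = 1 -> N (T x) < 1 + eta ->
  forall eta', 0 < eta' -> exists (S : {linear X -> Y}) (y : X),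
    [/\ forall u, N u <= N (S u), N y = 1, N (S y) < 1 + eta',
        forall u, N (S u - T u) <= e * N u & N (y - x) <= e].
have /choice[H HP] : forall k, exists eta, step (eps / 2 * h k) eta.
  move=> k; have ek : 0 < eps / 2 * h k.
    by rewrite mulr_gt0 ?geom_gt0// divr_gt0.
  by have [eta eta0 etaP] := perturbation_step scal X Yuc Me0 ek; exists eta.
(* [H k] permits the next step; [h k] makes the norms at the successive vectors tend to 1. *)
pose eta k := Num.min (H k) (h k).
have eta0 k : 0 < eta k by rewrite lt_min (proj1 (HP k)) geom_gt0.
exists (eta 0%N) => // T x TM Tlow x1 Tx.
pose state := ({linear X -> Y} * X)%type.
(* [eps * (1 - h k)] is the sum of the first [k] step sizes. *)
pose good k (s : state) :=
  [/\ forall u, N (s.1 u) <= (M + eps * (1 - h k)) * N u,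
      forall u, N u <= N (s.1 u), N s.2 = 1 & N (s.1 s.2) < 1 + eta k].
pose near_step k (s s' : state) :=
  (forall u, N (s'.1 u - s.1 u) <= eps / 2 * h k * N u) /\
  N (s'.2 - s.2) <= eps / 2 * h k.
(* A state that is not good is sent to itself, so that [next] is total. *)
have /choice[next nextP] : forall ks : nat * state, exists s',
    good ks.1 ks.2 -> good ks.1.+1 s' /\ near_step ks.1 ks.2 s'.
  move=> [k s]; have [sG|nG] := pselect (good k s); last by exists s.
  have [sM slow s1 seta] := sG; have [_ stepP] := HP k.
  have [||S [y [Slow y1 Sy ST yx]]] := stepP s.1 s.2 _ slow s1 _ _ (eta0 k.+1).
  - move=> u; apply: le_trans (sM u) _; rewrite ler_wpM2r ?(rnorm_ge0 scal)//.
    by rewrite lerD2l ler_piMr ?ltW// ltrBlDr ltrDl geom_gt0.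
  - by apply: lt_le_trans seta _; rewrite lerD2l ge_min lexx.
  exists (S, y) => _; split; last by split.
  split=> //= u; have := ler_rnorm_dist scal (s.1 u) (S u) 0; rewrite !subr0.
  have := sM u; have := ST u; have := geomS R k; nra.
pose fix s k : state := if k is k'.+1 then next (k', s k') else (T, x).
have sG k : good k (s k).
  elim: k => [|k IH]; last by have [] := nextP (k, s k) IH.
  by split=> // u; rewrite expr0 subrr mulr0 addr0.
have sN k : near_step k (s k) (s k.+1) by have [] := nextP (k, s k) (sG k).
have two : 2 * (eps / 2) = eps by field.
have [y yP] := geometric_cvg scal (fun k => proj2 (sN k)).
have /choice[S0 S0P] : forall u, exists v, forall k,
    N ((s k).1 u - v) <= eps * N u * h k.
  move=> u; have [|v vP] := @geometric_cvg _ _ _ _ scal Y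
      (fun k => (s k).1 u) (eps / 2 * N u).
    by move=> k; rewrite mulrAC; exact: (proj1 (sN k)).
  by exists v => k; apply: le_trans (vP k) _; rewrite mulrA two.
have [S SE] : exists S : {linear X -> Y}, S =1 S0.
  apply: linear_of_fun => a u v; apply/eqP.
  rewrite -subr_eq0 -(rnorm_eq0 scal) eq_le (rnorm_ge0 scal) andbT.
  (* [C * h k] collects the three errors of replacing [S0] by the [k]-th operator, which is
     linear. *)
  pose C := eps * N (a *: u + v) + re `|a| * (eps * N u) + eps * N v.
  apply: (@ler_addgeom _ _ _ C) => k; rewrite add0r.
  have -> : S0 (a *: u + v) - (a *: S0 u + S0 v) =
      - ((s k).1 (a *: u + v) - S0 (a *: u + v)) +
      (a *: ((s k).1 u - S0 u) + ((s k).1 v - S0 v)).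
    by rewrite [(s k).1 _]linearP scalerBr addrACA -opprD opprB [RHS]addrA subrK.
  apply: le_trans (ler_rnormD scal _ _) _; rewrite (rnormN re).
  have := ler_rnormD scal (a *: ((s k).1 u - S0 u)) ((s k).1 v - S0 v).
  rewrite (rnormZ scal).
  have a0 : 0 <= re `|a| by rewrite -(rs_le scal) rmorph0 (rs_ge0 scal).
  have := ler_wpM2l a0 (S0P u k).
  have := S0P (a *: u + v) k; have := S0P v k; rewrite /C; lra.
have SP u k : N ((s k).1 u - S u) <= eps * N u * h k by rewrite SE.
have Slow u : N u <= N (S u).
  apply: (@ler_addgeom _ _ _ (eps * N u)) => k.
  have [_ /(_ u) low _ _] := sG k.
  have := ler_rnorm_dist scal (S u) ((s k).1 u) 0.
  by rewrite !subr0; have := SP u k; lra.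
have ST u : N (S u - T u) <= eps * N u.
  by have := SP u 0%N; rewrite expr0 mulr1 (rnormB re).
have {}yP k : N ((s k).2 - y) <= eps * h k by have := yP k; rewrite two.
have y1 : N y = 1.
  apply/eqP; rewrite eq_le; apply/andP; split.
    apply: (@ler_addgeom _ _ _ eps) => k; have [_ _ s1 _] := sG k.
    have := ler_rnorm_dist scal (s k).2 y 0.
    by rewrite !subr0 s1 (rnormB re); have := yP k; lra.
  apply: (@ler_addgeom _ _ _ eps) => k; have [_ _ s1 _] := sG k.
  have := ler_rnorm_dist scal y (s k).2 0.
  by rewrite !subr0 s1; have := yP k; lra.
exists S, y; split=> //; last first.
  by have := yP 0%N; rewrite expr0 mulr1 (rnormB re).
apply/eqP; rewrite eq_le -{2}y1 Slow andbT.
(* The three terms come from replacing [y] by the [k]-th vector, [S] by the [k]-th operator, and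
   from [eta k <= h k]. *)
apply: (@ler_addgeom _ _ _ ((M + eps) * eps + eps + 1)) => k.
have [_ _ s1 seta] := sG k.
have etah : eta k <= h k by rewrite ge_min lexx orbT.
have SM u : N (S u) <= (M + eps) * N u.
  have := ler_rnorm_dist scal (T u) (S u) 0; rewrite !subr0.
  by have := TM u; have := ST u; lra.
have := ler_rnorm_dist scal (S (s k).2) (S y) 0; rewrite !subr0.
have := ler_rnorm_dist scal ((s k).1 (s k).2) (S (s k).2) 0; rewrite !subr0.
rewrite (rnormB re (S _)) (rnormB re (S y)) -linearB.
have := SP (s k).2 k; rewrite s1.
have := le_trans (SM ((s k).2 - y)) (ler_wpM2l (ltW Me0) (yP k)).
lra.
Qed.

(** Dividing by [rho] reduces to minimum norm 1, with [r / rho] as the bound on the operators. *)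
Lemma minnorm_attaining_approximation (X Y : completeNormedModType K) :
  uniformly_convex re Y ->
  forall e r rho : R, 0 < e -> 0 < rho -> rho <= r -> exists2 eta, 0 < eta &
  forall (T : {linear X -> Y}) (x : X), bounded_op T -> N x = 1 ->
    opnorm re T <= r -> minnorm re T = rho -> N (T x) < rho * (1 + eta) ->
  exists (S : {linear X -> Y}) (y : X),
    [/\ forall u, rho * N u <= N (S u), N y = 1, N (S y) = rho,
        forall u, N (T u - S u) <= e * N u & N (x - y) <= e].
Proof.
move=> Yuc e r rho e0 rho0 rhor.
have M0 : 0 < r / rho by rewrite divr_gt0// (lt_le_trans rho0).
(* Scaling back multiplies the operator error by [rho] but leaves the vector error as it is. *)
pose eps := Num.min e (e / rho).
have eps0 : 0 < eps by rewrite lt_min e0 divr_gt0.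
have epse : eps <= e by rewrite ge_min lexx.
have epsrho : eps * rho <= e by rewrite -ler_pdivlMr// ge_min lexx orbT.
have [eta eta0 etaP] := minnorm1_attaining_approximation X Yuc M0 eps0.
exists eta => // T x Tb x1 Tr Tm Tx.
have [T1 T1E] : exists T1 : {linear X -> Y}, forall u, T1 u = c rho^-1 *: T u.
  apply: linear_of_fun => a u v.
  by rewrite linearP scalerDr !scalerA mulrC.
have NT1 u : N (T1 u) = N (T u) / rho.
  by rewrite T1E (rnormZr scal) gtr0_norm ?invr_gt0// mulrC.
have [|||S1 [y [Slow y1 Sy ST yx]]] := etaP T1 x _ _ x1.
- move=> u; rewrite NT1 mulrAC ler_wpM2r ?invr_ge0 ?(ltW rho0)//.
  apply: le_trans (opnorm_ge scal u Tb) _.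
  by rewrite ler_wpM2r// (rnorm_ge0 scal).
- by move=> u; rewrite NT1 ler_pdivlMr// mulrC -Tm (minnorm_le scal).
- by rewrite NT1 ltr_pdivrMr// mulrC.
have [S SE] : exists S : {linear X -> Y}, forall u, S u = c rho *: S1 u.
  apply: linear_of_fun => a u v.
  by rewrite linearP scalerDr !scalerA mulrC.
have NS u : N (S u) = rho * N (S1 u) by rewrite SE (rnormZr scal) gtr0_norm.
exists S, y; split=> // [u| |u|].
- by rewrite NS ler_pM2l.
- by rewrite NS Sy mulr1.
- have -> : T u - S u = c rho *: (T1 u - S1 u).
    rewrite scalerBr SE T1E scalerA -rmorphM divff ?gt_eqF//.
    by rewrite rmorph1 scale1r.
  rewrite (rnormZr scal) gtr0_norm// (rnormB re).
  have := ST u; have := rnorm_ge0 scal u; nra.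
- by rewrite (rnormB re); apply: le_trans yx _.
Qed.

Lemma minnorm0_attaining_approximation (X Y : normedModType K)
    (T : {linear X -> Y}) (x : X) : N x = 1 ->
  exists2 S : {linear X -> Y}, S x = 0 &
    forall u, N (T u - S u) <= N (T x) * N u.
Proof.
move=> x1; have [g [gL gN gx]] := norming_functional scal x.
have [S SE] : exists S : {linear X -> Y}, forall u, S u = T u - g u *: T x.
  apply: linear_of_fun => a u v.
  by rewrite linearP gL scalerDl opprD addrACA scalerBr scalerA.
exists S => [|u].
  by rewrite SE gx -(rnormE scal) x1 rmorph1 scale1r subrr.
rewrite SE opprB addrC subrK (rnormZ scal) mulrC ler_wpM2l//.
exact: (rnorm_ge0 scal).
Qed.

Lemma bounded_BPBp_m_uniformly_convex (X Y : completeNormedModType K) :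
  uniformly_convex re Y -> bounded_BPBp_m re X Y.
Proof.
move=> Yuc.
(* Halving [e] leaves room for the strict inequalities: a pointwise bound passes to the supremum
   only as a weak one. *)
pose good e r rho (eta : R) := 0 < eta /\ forall (T : {linear X -> Y}) (x : X),
  bounded_op T -> N x = 1 -> opnorm re T <= r -> minnorm re T = rho ->
  (0 < rho -> N (T x) < rho * (1 + eta)) -> (rho = 0 -> N (T x) < eta) ->
  exists (S : {linear X -> Y}) (y : X),
    [/\ forall u, rho * N u <= N (S u), N y = 1, N (S y) = rho,
        forall u, N (T u - S u) <= e / 2 * N u & N (x - y) <= e / 2].
have good_le e r rho eta eta' : 0 < eta' -> eta' <= eta ->
    good e r rho eta -> good e r rho eta'.
  move=> eta'0 eta'le [_ etaP]; split=> // T x Tb x1 Tr Tm Tpos T0.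
  apply: etaP => // rho0; last exact: lt_le_trans (T0 rho0) _.
  by apply: lt_le_trans (Tpos rho0) _; rewrite ler_pM2l// lerD2l.
have ex_good (p : R * R * R) : exists eta, let: (e, r, rho) := p in
    0 < e -> 0 <= rho -> rho <= r -> [/\ good e r rho eta, eta < 1 & eta <= e].
  case: p => [[e r] rho].
  have [e0|] := ltP 0 e; last by exists 0.
  have [rho_ge0|] := leP 0 rho; last by exists 0.
  have [rhor|] := leP rho r; last by exists 0.
  have e20 : 0 < e / 2 by rewrite divr_gt0.
  have [eta eta_good] : exists eta, good e r rho eta.
    have [rho0|rho0] := eqVneq rho 0.
      exists (e / 2); split=> // T x Tb x1 Tr Tm _ /(_ rho0) Tx.
      have [S Sx ST] := minnorm0_attaining_approximation T x1.
      exists S, x; split=> // [u| |u|].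
      - by rewrite rho0 mul0r (rnorm_ge0 scal).
      - by rewrite Sx (rnorm0 scal).
      - by apply: le_trans (ST u) _; rewrite ler_wpM2r ?(rnorm_ge0 scal)// ltW.
      - by rewrite subrr (rnorm0 scal) ltW.
    have rho_gt0 : 0 < rho by rewrite lt_def rho0.
    have [eta eta0 etaP] :=
      minnorm_attaining_approximation X Yuc e20 rho_gt0 rhor.
    by exists eta; split=> // T x Tb x1 Tr Tm /(_ rho_gt0) Tx _; exact: etaP.
  have [eta0 _] := eta_good.
  (* [2^-1] keeps the value below 1, and [e] makes it tend to 0 with [e]. *)
  exists (Num.min eta (Num.min 2^-1 e)) => _ _ _; split.
  - apply: good_le eta_good; last by rewrite ge_min lexx.
    by rewrite !lt_min eta0 e0 invr_gt0 ltr0n.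
  - by rewrite !gt_min invf_lt1 ?ltr1n// orbT.
  - by rewrite !ge_min lexx !orbT.
have [f fP] := choice ex_good.
exists (fun e r rho => f (e, r, rho)).
split=> [r rho rho0 rhor|e r rho e0 rho0 rhor].
  apply/cvgrPdist_lt => e e0; near=> d.
  have d0 : 0 < d by near: d; exact: nbhs_right_gt.
  have [[f0 _] _ fd] := fP (d, r, rho) d0 rho0 rhor.
  rewrite sub0r normrN gtr0_norm//; apply: le_lt_trans fd _.
  by near: d; exact: nbhs_right_lt.
have [[f0 fgood] f1 _] := fP (e, r, rho) e0 rho0 rhor.
split=> [|T x Tb /(unit_sphereE scal)x1 Tr Tm Tpos T0]; first by rewrite f0 f1.
rewrite Tm in Tpos.
have [S [y [Slow y1 Sy ST xy]]] := fgood T x Tb x1 Tr Tm Tpos T0.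
have Sm : minnorm re S = rho by exact: (minnorm_attained scal y1 Slow Sy).
have [C TC] := (bounded_opP scal T).1 Tb.
exists S, y; split; last by lra.
- apply/(bounded_opP scal); exists (C + e / 2) => u.
  have := ler_rnorm_dist scal (T u) (S u) 0; rewrite !subr0 (rnormB re).
  by have := ST u; have := TC u; lra.
- exact/(unit_sphereE scal).
- by rewrite Sy Sm Tm.
- apply: le_lt_trans (_ : e / 2 < e); last by lra.
  by apply: (opnorm_le scal x1) => u u1; have := ST u; rewrite u1 mulr1.
Unshelve. all: by end_near. Qed.

End Main.

Theorem corollary3p20 (R : realType) :
  (forall X Y : completeNormedModType R,
     (exists x : X, x != 0) -> (exists y : Y, y != 0) ->
     uniformly_convex (fun a : R => a) Y ->
     bounded_BPBp_m (fun a : R => a) X Y) /\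
  (forall X Y : completeNormedModType R[i],
     (exists x : X, x != 0) -> (exists y : Y, y != 0) ->
     uniformly_convex (@complex.Re R) Y ->
     bounded_BPBp_m (@complex.Re R) X Y).
Proof.
split=> X Y _ _ Yuc.
  exact: (bounded_BPBp_m_uniformly_convex (@real_scalars_real R)).
exact: (bounded_BPBp_m_uniformly_convex (@real_scalars_complex R)).
Qed.
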